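(* There are recursive functions $u,v : \mathcal{N}\times\mathcal{N}\to\mathcal{N}$ such that whenever $\alpha,\beta\in\mathcal{N}$ are analytic codes for disjoint sets $A,B\subseteq 2^\omega$ respectively, with $A$ monotone, then there is a semi-positive set $C\subseteq 2^\omega$ with $A\subseteq C$, $C\cap B=\emptyset$ and such that (i) $u(\alpha,\beta)$ is a Borel code for $C$; (ii) $v(\alpha,\beta)$ is a semi-positive code for $C$.
   Context: Coding conventions. $\omega$ is the set of natural numbers, $\mathcal{N}=\omega^\omega$. For a finite sequence of naturals, $\langle u_0,\dots,u_{n-1}\rangle=p_0^{u_0+1}\cdots p_{n-1}^{u_{n-1}+1}$, where $(p_n)_{n\in\omega}$ enumerates the primes in increasing order, and $\langle\emptyset\rangle=1$. If $s=\langle u_0,\dots,u_{n-1}\rangle$ and $i<n$ then $(s)_i=u_i$; in all other cases $(s)_i=0$. Put $q(s)=(s)_0/((s)_1+1)$. For $\alpha\in\mathcal{N}$, $\alpha^*(t)=\alpha(t+1)$. Spaces. A recursive Polish space $\mathcal{X}$ (such as $\omega$, $2^\omega$, $\mathcal{N}$, $\mathbb{R}$ and their finite products) comes with a fixed complete metric $d_{\mathcal{X}}$ and a fixed recursive presentation $(r^{\mathcal{X}}_i)_{i\in\omega}$ (a dense sequence for which the relations $d(r_i,r_j)<q(k)$ and $d(r_i,r_j)\le q(k)$ are recursive); finite products carry the maximum metric and $r^{\mathcal{X}_0\times\dots\times\mathcal{X}_n}_s=(r^{\mathcal{X}_0}_{(s)_0},\dots,r^{\mathcal{X}_n}_{(s)_n})$.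 $N(\mathcal{X},s)$ is the open $d_{\mathcal{X}}$-ball with center $r^{\mathcal{X}}_{(s)_0}$ and radius $q((s)_1)$. A function $f:\mathcal{X}\to\mathcal{Y}$ is recursive if $\{(x,s): f(x)\in N(\mathcal{Y},s)\}$ is $\Sigma^0_1$ (semirecursive). Universal sets. $U^{\mathcal{X}}(\alpha)=\bigcup_{n}N(\mathcal{X},\alpha(n))$, $F^{\mathcal{X}}(\alpha)=\mathcal{X}\setminus U^{\mathcal{X}}(\alpha)$, and $G_1^{\mathcal{X}}(\alpha)=\{x\in\mathcal{X}: \exists\gamma\in\mathcal{N}\ (x,\gamma)\in F^{\mathcal{X}\times\mathcal{N}}(\alpha)\}$. $\alpha$ is an analytic code for $P\subseteq\mathcal{X}$ if $P=G_1^{\mathcal{X}}(\alpha)$. Partial recursive functions. For $\alpha\in\mathcal{N}$, $\{\alpha\}:\omega\rightharpoonup\mathcal{N}$ is the largest partial function such that, on its domain, $\{\alpha\}(n)\in N(\mathcal{N},s)\iff (n,s)\in U^{\omega\times\omega}(\alpha)$ for all $s$; i.e. $\{\alpha\}(n)$ is defined iff there is a unique $y\in\mathcal{N}$ with $y\in N(\mathcal{N},s)\iff (n,s)\in U^{\omega\times\omega}(\alpha)$ for all $s$, and then it equals this $y$. Borel codes. $\alpha\in BC_0$ iff $\alpha(0)=0$; for $\xi>0$, $\alpha\in BC_\xi$ iff $\alpha(0)=1$ and for all $n$, $\{\alpha^*\}(n)$ is defined and belongs to $BC_\eta$ for some $\eta<\xi$. $BC=\bigcup_{\xi<\omega_1}BC_\xi$.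 For $\alpha\in BC$, the coded Borel subset $\pi c(\alpha)$ of $\mathcal{X}$ (here $\mathcal{X}=2^\omega$) is $\mathcal{X}\setminus N(\mathcal{X},\alpha(1))$ if $\alpha(0)=0$, and $\bigcup_n(\mathcal{X}\setminus\pi c(\{\alpha^*\}(n)))$ if $\alpha(0)=1$. $\alpha$ is a Borel code for $\pi c(\alpha)$. Semi-positive sets and codes. $\{x\in 2^\omega: x(n)=1\}$ is denoted $U_n$. A set $A\subseteq 2^\omega$ is semi-positive if it belongs to the least family containing $\{U_n: n\in\omega\}\cup\{\emptyset,2^\omega\}$ and closed under countable unions and countable intersections. A set $A\subseteq 2^\omega$ is monotone if $x\in A$ and $\{n:x(n)=1\}\subseteq\{n:y(n)=1\}$ imply $y\in A$. Put $V_0=\emptyset$, $V_1=2^\omega$, $V_{n+2}=U_n$. $\alpha\in SPC_0$ iff $\alpha(0)=0$; for $\xi>0$, $\alpha\in SPC_\xi$ iff $\alpha(0)=1$ and for all $i,j$, $\{\alpha^*\}(\langle i,j\rangle)$ is defined and belongs to $SPC_\eta$ for some $\eta<\xi$. $SPC=\bigcup_{\xi<\omega_1}SPC_\xi$. For $\alpha\in SPC$, $\tau(\alpha)=V_{\alpha^*(1)}$ if $\alpha(0)=0$, and $\tau(\alpha)=\bigcup_i\bigcap_j\tau(\{\alpha^*\}(\langle i,j\rangle))$ if $\alpha(0)=1$. $\alpha\in SPC$ is a semi-positive code for $\tau(\alpha)$. *)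

(* Defs.v *)
From mathcomp Require Import all_boot all_classical.
From Stdlib Require Rdefinitions Rbasic_fun Raxioms.

Set Implicit Arguments.
Unset Strict Implicit.
Unset Printing Implicit Defensive.

Local Open Scope classical_set_scope.

Local Notation R := Rdefinitions.R.
Local Notation INR := Raxioms.INR.
Local Notation Rlt := Rdefinitions.Rlt.
Local Notation Rdiv := Rdefinitions.Rdiv.
Local Notation Rmax := Rbasic_fun.Rmax.

(* The least class containing the basic functions and closed under
   composition, primitive recursion and minimization of regular functions
   (the last two through the defining equations of the resulting function). *)
Inductive recursive : forall n, (n.-tuple nat -> nat) -> Prop :=
| Rec_zero : recursive (fun _ : 0.-tuple nat => 0)
| Rec_succ : recursive (fun v : 1.-tuple nat => (thead v).+1)
| Rec_proj n (i : 'I_n) : recursive (fun v : n.-tuple nat => tnth v i)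
| Rec_comp m n (f : m.-tuple nat -> nat) (g : 'I_m -> n.-tuple nat -> nat) :
    recursive f -> (forall i, recursive (g i)) ->
    recursive (fun v : n.-tuple nat => f [tuple g i v | i < m])
| Rec_primrec n (f : n.-tuple nat -> nat) (g : n.+2.-tuple nat -> nat)
      (h : n.+1.-tuple nat -> nat) :
    recursive f -> recursive g ->
    (forall v, h (cons_tuple 0 v) = f v) ->
    (forall k v, h (cons_tuple k.+1 v) =
       g (cons_tuple k (cons_tuple (h (cons_tuple k v)) v))) ->
    recursive h
| Rec_mu n (f : n.+1.-tuple nat -> nat) (g : n.-tuple nat -> nat) :
    recursive f ->
    (forall v, f (cons_tuple (g v) v) = 0) ->
    (forall v k, k < g v -> f (cons_tuple k v) <> 0) ->
    recursive g.

Definition recursive1 (e : nat -> nat) : Prop :=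
  recursive (fun v : 1.-tuple nat => e (thead v)).

Lemma prime_above_ex m : exists p, (m < p) && prime p.
Proof. by have [p mp pp] := prime_above m; exists p; rewrite mp. Qed.

Definition next_prime (m : nat) : nat := ex_minn (prime_above_ex m).

Fixpoint nth_prime (n : nat) : nat :=
  if n is n'.+1 then next_prime (nth_prime n') else 2.

Definition code (u : seq nat) : nat :=
  \prod_(i < size u) nth_prime i ^ (nth 0 u i).+1.

(* [code] is injective; the value is [::] when s is not a code. *)
Definition decode (s : nat) : seq nat := xget [::] [set u | code u = s].

Definition entry (s i : nat) : nat := nth 0 (decode s) i.

Definition q (s : nat) : R := Rdiv (INR (entry s 0)) (INR (entry s 1).+1).

(* The data of a recursive Polish space that enter the definitions below:
   the metric and the recursive presentation.  Only the standard spaces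
   omega, 2^omega, omega^omega and their binary products are used. *)
Structure presented := Presented {
  point :> Type;
  dist : point -> point -> R;
  rpoint : nat -> point }.

Definition ball (X : presented) (s : nat) : set X :=
  [set x | Rlt (dist (rpoint X (entry s 0)) x) (q (entry s 1))].
Arguments ball : clear implicits.

Definition omega : presented :=
  @Presented nat (fun m n => INR (m != n)) id.

Definition seq_dist (T : eqType) (x y : nat -> T) : R :=
  if pselect (exists n, x n != y n) is left h
  then Rdiv (INR 1) (INR (ex_minn h).+1) else INR 0.

Definition Baire : presented :=
  @Presented (nat -> nat) (@seq_dist nat) entry.

Definition Cantor : presented :=
  @Presented (nat -> bool) (@seq_dist bool) (fun s n => entry s n != 0).

Definition prodp (X Y : presented) : presented :=
  @Presented (X * Y)
    (fun p p' => Rmax (dist p.1 p'.1) (dist p.2 p'.2))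
    (fun s => (rpoint X (entry s 0), rpoint Y (entry s 1))).

Definition semirecursive (X : presented) (P : set X) : Prop :=
  exists2 e : nat -> nat, recursive1 e & P = \bigcup_n ball X (e n).

Definition recursive_map (X Y : presented) (f : X -> Y) : Prop :=
  @semirecursive (prodp X omega) [set p | ball Y p.2 (f p.1)].

Definition univ_open (X : presented) (a : Baire) : set X :=
  \bigcup_n ball X (a n).
Arguments univ_open : clear implicits.

Definition univ_closed (X : presented) (a : Baire) : set X :=
  ~` univ_open X a.
Arguments univ_closed : clear implicits.

Definition univ_analytic (X : presented) (a : Baire) : set X :=
  [set x | exists g : Baire, univ_closed (prodp X Baire) a (x, g)].
Arguments univ_analytic : clear implicits.

Definition analytic_code (X : presented) (a : Baire) (P : set X) : Prop :=
  P = univ_analytic X a.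

(* [kleene a n y]: {a}(n) is defined and equal to y *)
Definition kleene (a : Baire) (n : nat) : Baire -> Prop :=
  unique (fun y : Baire =>
    forall s, ball Baire s y <-> univ_open (prodp omega omega) a (n, s)).

Definition shift (a : Baire) : Baire := fun t => a t.+1.

(* Countable ordinals are given as positions in well-orderings of the
   natural numbers: every ordinal below omega_1 is the order type of the
   predecessors of some k in some such ordering, and conversely. *)
Record countable_wo := CountableWO {
  wo_lt : nat -> nat -> Prop;
  wo_trans : forall i j k, wo_lt i j -> wo_lt j k -> wo_lt i k;
  wo_total : forall i j, [\/ wo_lt i j, i = j | wo_lt j i];
  wo_wf : well_founded wo_lt }.

Definition wo_zero (W : countable_wo) (xi : nat) : Prop :=
  forall eta, ~ wo_lt W eta xi.

(* The level xi of the hierarchy in which the immediate subcodes of a are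
   the {a^*}(c i), i in I. *)
Definition code_step (I : Type) (c : I -> nat) (W : countable_wo) (xi : nat)
    (level : forall eta, wo_lt W eta xi -> set Baire) : set Baire :=
  [set a | (wo_zero W xi /\ a 0 = 0) \/
    [/\ ~ wo_zero W xi, a 0 = 1 &
      forall i, exists2 b, kleene (shift a) (c i) b &
        exists eta (h : wo_lt W eta xi), level eta h b]].

Definition code_level (I : Type) (c : I -> nat) (W : countable_wo) :
    nat -> set Baire :=
  Fix (wo_wf W) (fun _ => set Baire) (@code_step I c W).

Lemma code_levelE (I : Type) (c : I -> nat) (W : countable_wo) (xi : nat) :
  code_level c W xi =
  [set a | (wo_zero W xi /\ a 0 = 0) \/
    [/\ ~ wo_zero W xi, a 0 = 1 &
      forall i, exists2 b, kleene (shift a) (c i) b &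
        exists2 eta, wo_lt W eta xi & code_level c W eta b]].
Proof.
rewrite /code_level Fix_eq; last first.
  move=> x f g fg; congr (code_step c _).
  by apply: functional_extensionality_dep => y;
     apply: functional_extensionality_dep => p.
apply/seteqP; split=> a [h|[nz a1 h]]; first [by left | right];
  split=> // i; have [b kb] := h i.
- by move=> [eta [l lb]]; exists b => //; exists eta.
- by move=> [eta l lb]; exists b => //; exists eta, l.
Qed.

Definition codes (I : Type) (c : I -> nat) : set Baire :=
  [set a | exists W xi, code_level c W xi a].

Definition BC : set Baire := codes (fun n : nat => n).

(* the graph of the coded-set map on [BC]; see [pi_c_exists_unique] *)
Inductive pi_c (X : presented) : Baire -> set X -> Prop :=
| Pi_c0 (a : Baire) : a 0 = 0 -> pi_c a (~` ball X (a 1))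
| Pi_c1 (a : Baire) (b : nat -> Baire) (P : nat -> set X) :
    a 0 = 1 ->
    (forall n, kleene (shift a) n (b n)) ->
    (forall n, pi_c (b n) (P n)) ->
    pi_c a (\bigcup_n ~` P n).

Definition borel_code (X : presented) (a : Baire) (P : set X) : Prop :=
  BC a /\ pi_c a P.

Definition U (n : nat) : set Cantor := [set x | x n = true].

Inductive semi_positive : set Cantor -> Prop :=
| SP_U n : semi_positive (U n)
| SP_empty : semi_positive set0
| SP_full : semi_positive setT
| SP_bigcup (P : nat -> set Cantor) :
    (forall n, semi_positive (P n)) -> semi_positive (\bigcup_n P n)
| SP_bigcap (P : nat -> set Cantor) :
    (forall n, semi_positive (P n)) -> semi_positive (\bigcap_n P n).

Definition monotone (A : set Cantor) : Prop :=
  forall x y : Cantor, A x -> [set n | x n = true] `<=` [set n | y n = true] ->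
    A y.

Definition V (n : nat) : set Cantor :=
  match n with 0 => set0 | 1 => setT | m.+2 => U m end.

Definition SPC : set Baire :=
  codes (fun p : nat * nat => code [:: p.1; p.2]).

(* the graph of the coded-set map on [SPC]; see [tau_exists_unique] *)
Inductive tau : Baire -> set Cantor -> Prop :=
| Tau0 (a : Baire) : a 0 = 0 -> tau a (V (shift a 1))
| Tau1 (a : Baire) (b : nat -> nat -> Baire) (P : nat -> nat -> set Cantor) :
    a 0 = 1 ->
    (forall i j, kleene (shift a) (code [:: i; j]) (b i j)) ->
    (forall i j, tau (b i j) (P i j)) ->
    tau a (\bigcup_i \bigcap_j P i j).

Definition semi_positive_code (a : Baire) (P : set Cantor) : Prop :=
  SPC a /\ tau a P.

Lemma kleene_inj (a : Baire) n (y z : Baire) :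
  kleene a n y -> kleene a n z -> y = z.
Proof. by move=> [_ uy] [pz _]; apply: uy. Qed.

Lemma pi_c_fun (X : presented) (a : Baire) (P Q : set X) :
  pi_c a P -> pi_c a Q -> P = Q.
Proof.
move=> aP; elim: aP Q => {a P} [a a0|a b P a1 kb _ IH] Q aQ.
  by case: aQ a0 => // a' b' P' ->.
case: aQ a1 kb => [a' -> //|a' b' P' _ kb' pP' _ kb].
apply: eq_bigcupr => n _; congr (~` _); apply: IH.
by rewrite (kleene_inj (kb n) (kb' n)).
Qed.

Lemma tau_fun (a : Baire) (P Q : set Cantor) : tau a P -> tau a Q -> P = Q.
Proof.
move=> aP; elim: aP Q => {a P} [a a0|a b P a1 kb _ IH] Q aQ.
  by case: aQ a0 => // a' b' P' ->.
case: aQ a1 kb => [a' -> //|a' b' P' _ kb' pP' _ kb].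
apply: eq_bigcupr => i _; apply: eq_bigcapr => j _; apply: IH.
by rewrite (kleene_inj (kb i j) (kb' i j)).
Qed.

Lemma codes_ind (I : Type) (c : I -> nat) (S : Baire -> Prop) :
  (forall a : Baire, a 0 = 0 -> S a) ->
  (forall (a : Baire) (b : I -> Baire), a 0 = 1 ->
    (forall i, kleene (shift a) (c i) (b i)) -> (forall i, S (b i)) -> S a) ->
  forall a, codes c a -> S a.
Proof.
move=> S0 S1 a [W [xi]]; elim/(well_founded_ind (wo_wf W)): xi a => xi IH a.
rewrite code_levelE => -[[_ a0]|[_ a1 h]]; first exact: S0.
have /choice[b hb] : forall i, exists b, kleene (shift a) (c i) b /\ S b.
  by move=> i; have [b kb [eta lt_eta lb]] := h i; exists b; split=> //;
     apply: (IH eta).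
by apply: (S1 a b) => // i; have [] := hb i.
Qed.

Lemma pi_c_exists_unique (X : presented) (a : Baire) :
  BC a -> exists! P : set X, pi_c a P.
Proof.
move=> aBC; suff [P aP] : exists P : set X, pi_c a P.
  by exists P; split=> // Q; apply: pi_c_fun.
move: a aBC; apply: codes_ind => [a a0|a b a1 kb /choice[P bP]].
  by exists (~` ball X (a 1)); apply: Pi_c0.
by exists (\bigcup_n ~` P n); exact: Pi_c1 a1 kb bP.
Qed.

Lemma tau_exists_unique (a : Baire) :
  SPC a -> exists! P : set Cantor, tau a P.
Proof.
move=> aSPC; suff [P aP] : exists P : set Cantor, tau a P.
  by exists P; split=> // Q; apply: tau_fun.
move: a aSPC; apply: codes_ind => [a a0|a b a1 kb /choice[P bP]].
  by exists (V (shift a 1)); apply: Tau0.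
exists (\bigcup_i \bigcap_j P (i, j)).
exact: (Tau1 a1 (fun i j => kb (i, j)) (fun i j => bP (i, j))).
Qed.

(* Main.v *)
(* Search for x in A and y in B with x <= y coordinatewise, together with
   witnesses of membership: a node is a pair of finite approximations (x, g),
   (y, h), and the search fails at a node when a basic ball enumerated by [a]
   covers the (x, g) part, when one enumerated by [b] covers the (y, h) part, or
   when x n = 1 and y n = 0.  Since A is monotone and disjoint from B, every
   branch fails.  By bar recursion each node u carries a set C_u separating the
   part of A above u from the part of B above u: the empty set, the full set or
   U_n at a failure of the respective kind, and otherwise the union over i of the
   intersections over j of C_(u, i, j), where i extends (x, g) and j extends (y, h).

   The codes of the C_u are uniformly recursive without an appeal to the recursion
   theorem: the code of a node must enumerate the pairs (n, s) such that the code
   of its n-th child lies in the ball N(s), and this is done by letting the value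
   at <n, s, t> emit (n, s) when t is a correct finite table of values of the
   child's code that puts it into N(s).  Correctness of t only involves tables
   smaller than t, so it is defined by course-of-values recursion. *)

From Stdlib Require Import Reals Lra.
Require Import Defs.
From mathcomp Require Import all_boot all_classical zify.

Set Implicit Arguments.
Unset Strict Implicit.
Unset Printing Implicit Defensive.

Local Open Scope nat_scope.
Local Open Scope classical_set_scope.

(** * Recursive functions *)

Definition tl n (w : n.+1.-tuple nat) : n.-tuple nat := behead_tuple w.
Definition hd n (w : n.+1.-tuple nat) : nat := thead w.

Lemma hd_cons n x (v : n.-tuple nat) : hd (cons_tuple x v) = x.
Proof. by rewrite /hd theadE. Qed.

Lemma tl_cons n x (v : n.-tuple nat) : tl (cons_tuple x v) = v.
Proof. exact: val_inj. Qed.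

(* Opaque constants keep unification syntactic, so each closure lemma fires on one head symbol. A
   predicate counts as recursive when its 0/1 value is. *)
Create HintDb recursive discriminated.
Hint Constants Opaque : recursive.
Hint Variables Opaque : recursive.

Ltac prove_rec := typeclasses eauto 100 with recursive nocore.

Lemma rec_ext n (f g : n.-tuple nat -> nat) : recursive f -> f =1 g -> recursive g.
Proof. by move=> rf /funext <-. Qed.

Lemma rec_comp m n (f : m.-tuple nat -> nat) (phi : n.-tuple nat -> m.-tuple nat) :
  recursive f -> (forall i, recursive (fun v => tnth (phi v) i)) ->
  recursive (fun v => f (phi v)).
Proof.
move=> rf rphi; apply: rec_ext (Rec_comp rf rphi) _ => v.
by congr f; apply: eq_from_tnth => i; rewrite tnth_mktuple.
Qed.

Lemma rec_comp_cons m n (f : m.+1.-tuple nat -> nat) x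
    (phi : n.-tuple nat -> m.-tuple nat) :
  recursive f -> recursive x -> (forall i, recursive (fun v => tnth (phi v) i)) ->
  recursive (fun v => f (cons_tuple (x v) (phi v))).
Proof.
move=> rf rx rphi; apply: (rec_comp (phi := fun v => cons_tuple (x v) (phi v))) => // i.
case: (unliftP ord0 i) => [j|] ->; first by under eq_fun do rewrite tnthS.
by under eq_fun do rewrite tnth0.
Qed.

Lemma rec_hd n : recursive (@hd n).
Proof. exact: Rec_proj. Qed.

Lemma rec_tl n (f : n.-tuple nat -> nat) : recursive f -> recursive (fun w => f (tl w)).
Proof.
move=> rf; apply: rec_comp => // i; apply: rec_ext (Rec_proj (lift ord0 i)) _ => v.
by case/tupleP: v => x v; rewrite tnthS tl_cons.
Qed.

Lemma rec_tl2 n (f : n.-tuple nat -> nat) :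
  recursive f -> recursive (fun w => f (tl (tl w))).
Proof. by move=> rf; exact: rec_tl (rec_tl rf). Qed.

Lemma rec_tl3 n (f : n.-tuple nat -> nat) :
  recursive f -> recursive (fun w => f (tl (tl (tl w)))).
Proof. by move=> rf; exact: rec_tl (rec_tl2 rf). Qed.

Lemma rec_succ n (f : n.-tuple nat -> nat) : recursive f -> recursive (fun v => (f v).+1).
Proof.
move=> rf; have := @rec_comp_cons 0 n _ f (fun=> [tuple]) Rec_succ rf.
by rewrite /=; apply => -[].
Qed.

Lemma rec_zero n : recursive (fun _ : n.-tuple nat => 0).
Proof. by apply: (@rec_comp 0 n _ (fun=> [tuple]) Rec_zero) => -[]. Qed.

#[local] Hint Resolve rec_hd rec_tl rec_tl2 rec_tl3 rec_succ rec_zero : recursive.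

(** The defining equations of [iteri] are those of primitive recursion with the parameters [v]
    carried along; bounded constructions are reduced to it. *)
Lemma rec_iteri n (x b : n.-tuple nat -> nat) (s : nat -> nat -> n.-tuple nat -> nat) :
  recursive x -> recursive b ->
  recursive (fun w : n.+2.-tuple nat => s (hd w) (hd (tl w)) (tl (tl w))) ->
  recursive (fun v => iteri (x v) (fun k r => s k r v) (b v)).
Proof.
move=> rx rb rs.
pose h (w : n.+1.-tuple nat) := iteri (hd w) (fun k r => s k r (tl w)) (b (tl w)).
have rh : recursive h.
  by apply: (Rec_primrec rb rs) => [v|k v]; rewrite /h !hd_cons !tl_cons.
have /rec_ext := rec_comp_cons (phi := fun v => v) rh rx (@Rec_proj n); apply=> v.
by rewrite /h hd_cons tl_cons.
Qed.
#[local] Hint Resolve rec_iteri : recursive.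

Lemma rec_pred n (f : n.-tuple nat -> nat) : recursive f -> recursive (fun v => (f v).-1).
Proof.
move=> rf; have : recursive (fun v => iteri (f v) (fun k r => k) 0) by prove_rec.
by move/rec_ext; apply=> v; case: (f v).
Qed.
#[local] Hint Resolve rec_pred : recursive.

Section Arithmetic.
Variables (n : nat) (f g : n.-tuple nat -> nat).
Hypotheses (rf : recursive f) (rg : recursive g).

Lemma rec_add : recursive (fun v => f v + g v).
Proof.
have : recursive (fun v => iteri (f v) (fun _ r => r.+1) (g v)) by prove_rec.
by move/rec_ext; apply=> v; elim: (f v) => //= k ->.
Qed.

Lemma rec_sub : recursive (fun v => f v - g v).
Proof.
have : recursive (fun v => iteri (g v) (fun _ r => r.-1) (f v)) by prove_rec.
by move/rec_ext; apply=> v; elim: (g v) => /= [|k ->]; lia.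
Qed.

End Arithmetic.
#[local] Hint Resolve rec_add rec_sub : recursive.

Lemma rec_mul n (f g : n.-tuple nat -> nat) :
  recursive f -> recursive g -> recursive (fun v => f v * g v).
Proof.
move=> rf rg.
have : recursive (fun v => iteri (f v) (fun _ r => g v + r) 0) by prove_rec.
by move/rec_ext; apply=> v; elim: (f v) => //= k ->.
Qed.
#[local] Hint Resolve rec_mul : recursive.

Lemma rec_exp n (f g : n.-tuple nat -> nat) :
  recursive f -> recursive g -> recursive (fun v => f v ^ g v).
Proof.
move=> rf rg.
have : recursive (fun v => iteri (g v) (fun _ r => f v * r) 1) by prove_rec.
by move/rec_ext; apply=> v; elim: (g v) => //= k ->; rewrite expnS.
Qed.
#[local] Hint Resolve rec_exp : recursive.

Lemma rec_if n (b : n.-tuple nat -> bool) (f g : n.-tuple nat -> nat) :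
  recursive b -> recursive f -> recursive g ->
  recursive (fun v => if b v then f v else g v).
Proof.
move=> rb rf rg.
have : recursive (fun v => iteri (b v) (fun _ _ => f v) (g v)) by prove_rec.
by move/rec_ext; apply=> v; case: (b v).
Qed.

Lemma rec_eq0 n (f : n.-tuple nat -> nat) : recursive f -> recursive (fun v => f v == 0).
Proof.
move=> rf; have : recursive (fun v => 1 - f v) by prove_rec.
by move/rec_ext; apply=> v; case: (f v).
Qed.
#[local] Hint Resolve rec_if rec_eq0 : recursive.

Lemma rec_neg n (b : n.-tuple nat -> bool) : recursive b -> recursive (fun v => ~~ b v).
Proof.
move=> rb; have : recursive (fun v => (b v : nat) == 0) by prove_rec.
by move/rec_ext; apply=> v; case: (b v).
Qed.
#[local] Hint Resolve rec_neg : recursive.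

Lemma rec_and n (b c : n.-tuple nat -> bool) :
  recursive b -> recursive c -> recursive (fun v => b v && c v).
Proof.
move=> rb rb'; have : recursive (fun v => b v * c v) by prove_rec.
by move/rec_ext; apply=> v; case: (b v); case: (c v).
Qed.

Lemma rec_imp n (b c : n.-tuple nat -> bool) :
  recursive b -> recursive c -> recursive (fun v => b v ==> c v).
Proof.
move=> rb rb'; have : recursive (fun v => if b v then (c v : nat) else 1) by prove_rec.
by move/rec_ext; apply=> v; case: (b v); case: (c v).
Qed.

Lemma rec_leq n (f g : n.-tuple nat -> nat) :
  recursive f -> recursive g -> recursive (fun v => f v <= g v).
Proof. by move=> rf rg; rewrite /leq; prove_rec. Qed.
#[local] Hint Resolve rec_and rec_imp rec_leq : recursive.

Lemma rec_eq n (f g : n.-tuple nat -> nat) :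
  recursive f -> recursive g -> recursive (fun v => f v == g v).
Proof. by move=> rf rg; under eq_fun do rewrite eqn_leq; prove_rec. Qed.

Lemma rec_eqb n (b c : n.-tuple nat -> bool) :
  recursive b -> recursive c -> recursive (fun v => b v == c v).
Proof.
move=> rb rb'; have : recursive (fun v => if b v then (c v : nat) else ~~ c v) by prove_rec.
by move/rec_ext; apply=> v; case: (b v); case: (c v).
Qed.
#[local] Hint Resolve rec_eq rec_eqb : recursive.

Lemma rec_count n (x : n.-tuple nat -> nat) (P : n.-tuple nat -> nat -> bool) :
  recursive x -> recursive (fun w => P (tl w) (hd w)) ->
  recursive (fun v => count (P v) (iota 0 (x v))).
Proof.
move=> rx rP.
have rP' : recursive (fun w : n.+2.-tuple nat => P (tl (tl w)) (hd w)).
  pose phi (w : n.+2.-tuple nat) := cons_tuple (hd w) (tl (tl w)).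
  apply: rec_ext (@rec_comp_cons _ n.+2 _ (@hd _) (fun w => tl (tl w)) rP _ _) _.
  - by prove_rec.
  - by move=> i; exact: rec_tl (rec_tl (Rec_proj i)).
  - by move=> w; rewrite tl_cons hd_cons.
have : recursive (fun v => iteri (x v) (fun k r => r + P v k) 0) by prove_rec.
move/rec_ext; apply=> v; elim: (x v) => // k IH.
by rewrite [LHS]/= IH -[in RHS](addn1 k) iotaD count_cat /= addn0.
Qed.
#[local] Hint Resolve rec_count : recursive.

Lemma rec_has n (x : n.-tuple nat -> nat) (P : n.-tuple nat -> nat -> bool) :
  recursive x -> recursive (fun w => P (tl w) (hd w)) ->
  recursive (fun v => has (P v) (iota 0 (x v))).
Proof. by move=> rx rP; under eq_fun do rewrite has_count; prove_rec. Qed.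
#[local] Hint Resolve rec_has : recursive.

Lemma rec_all n (x : n.-tuple nat -> nat) (P : n.-tuple nat -> nat -> bool) :
  recursive x -> recursive (fun w => P (tl w) (hd w)) ->
  recursive (fun v => all (P v) (iota 0 (x v))).
Proof.
move=> rx rP; have : recursive (fun v => ~~ has (fun i => ~~ P v i) (iota 0 (x v))) by prove_rec.
by move/rec_ext; apply=> v; rewrite has_predC negbK.
Qed.
#[local] Hint Resolve rec_all : recursive.

Lemma rec_dvdn n (f g : n.-tuple nat -> nat) :
  recursive f -> recursive g -> recursive (fun v => f v %| g v).
Proof.
move=> rf rg.
have : recursive (fun v => has (fun i => i * f v == g v) (iota 0 (g v).+1)) by prove_rec.
move/rec_ext; apply=> v; congr nat_of_bool; apply/hasP/dvdnP => [[i _ /eqP <-]|[i ->]].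
  by exists i.
case: (posnP (f v)) => [->|f0]; first by exists 0; rewrite ?mem_iota ?muln0.
by exists i => //; rewrite mem_iota ltnS leq_pmulr.
Qed.
#[local] Hint Resolve rec_dvdn : recursive.

Lemma rec_prime n (f : n.-tuple nat -> nat) : recursive f -> recursive (fun v => prime (f v)).
Proof.
move=> rf.
have : recursive (fun v =>
  (1 < f v) && all (fun d => (d %| f v) ==> (d == 1)) (iota 0 (f v))) by prove_rec.
move/rec_ext; apply=> v; congr nat_of_bool; apply/idP/primeP => [/andP[f1 /allP h]|[f1 h]].
  split=> // d dv; have := dvdn_leq (ltnW f1) dv; rewrite leq_eqVlt => /predU1P[->|lt].
    by rewrite /= eqxx orbT.
  by have := h d; rewrite mem_iota dv /= => /(_ lt) ->.
rewrite f1; apply/allP => d; rewrite mem_iota add0n => /= lt; apply/implyP => /h /=.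
by rewrite (ltn_eqF lt) orbF.
Qed.
#[local] Hint Resolve rec_prime : recursive.

(** The one unbounded search. [Rec_mu] looks for a zero, hence the negated test; the existence of
    larger primes makes the search total. *)
Lemma rec_next_prime n (f : n.-tuple nat -> nat) :
  recursive f -> recursive (fun v => next_prime (f v)).
Proof.
move=> rf.
have rt : recursive (fun w : n.+1.-tuple nat =>
  ~~ ((f (tl w) < hd w) && prime (hd w))) by prove_rec.
apply: (Rec_mu rt) => [v|v k]; rewrite hd_cons tl_cons /next_prime.
  by case: ex_minnP => m ->.
by case: ex_minnP => m _ h km; case: (boolP (_ && _)) => // /h; rewrite leqNgt km.
Qed.
#[local] Hint Resolve rec_next_prime : recursive.

Lemma rec_nth_prime n (f : n.-tuple nat -> nat) :
  recursive f -> recursive (fun v => nth_prime (f v)).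
Proof.
move=> rf; have : recursive (fun v => iteri (f v) (fun _ r => next_prime r) 2) by prove_rec.
by move/rec_ext; apply=> v; elim: (f v) => //= k ->.
Qed.
#[local] Hint Resolve rec_nth_prime : recursive.

(** * Sequence codes *)

Lemma rec_const n c : recursive (fun _ : n.-tuple nat => c).
Proof. by elim: c => [|c IH]; [prove_rec | apply: rec_succ]. Qed.
#[local] Hint Resolve rec_const : recursive.

Lemma next_primeP m : (m < next_prime m) && prime (next_prime m).
Proof. by rewrite /next_prime; case: ex_minnP. Qed.

Lemma prime_nth_prime i : prime (nth_prime i).
Proof. by case: i => //= i; have /andP[] := next_primeP (nth_prime i). Qed.

Lemma nth_prime_homo : {homo nth_prime : i j / i < j}.
Proof.
apply: homo_ltn; first exact: ltn_trans.
by move=> i; have /andP[] := next_primeP (nth_prime i).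
Qed.

Lemma nth_prime_inj : injective nth_prime.
Proof.
by move=> i j; case: (ltngtP i j) => // /nth_prime_homo h e; rewrite e ltnn in h.
Qed.

Lemma code_rcons u x : code (rcons u x) = code u * nth_prime (size u) ^ x.+1.
Proof.
rewrite /code size_rcons big_ord_recr /= nth_rcons ltnn eqxx; congr (_ * _).
by apply: eq_bigr => i _; rewrite nth_rcons ltn_ord.
Qed.

Lemma code_gt0 u : 0 < code u.
Proof.
elim/last_ind: u => [|u x IH]; first by rewrite /code big_ord0.
by rewrite code_rcons muln_gt0 IH expn_gt0 prime_gt0 ?prime_nth_prime.
Qed.

Lemma logn_code u i :
  logn (nth_prime i) (code u) = if i < size u then (nth 0 u i).+1 else 0.
Proof.
elim/last_ind: u => [|u x IH]; first by rewrite /code big_ord0 logn1.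
rewrite code_rcons lognM ?code_gt0 ?expn_gt0 ?prime_gt0 ?prime_nth_prime //.
rewrite lognX (logn_prime _ (prime_nth_prime (size u))) (inj_eq nth_prime_inj) IH.
by rewrite size_rcons nth_rcons ltnS; case: (ltngtP i (size u)) => /= _; lia.
Qed.

Lemma size_code u : size u <= code u.
Proof.
elim/last_ind: u => // u x IH; rewrite size_rcons code_rcons.
apply: leq_ltn_trans IH _; rewrite -[X in X < _]muln1 ltn_pmul2l ?code_gt0 //.
by rewrite -(exp1n x.+1) ltn_exp2r // prime_gt1 ?prime_nth_prime.
Qed.

Lemma dvdn_code u i : (nth_prime i %| code u) = (i < size u).
Proof.
rewrite -{1}[nth_prime i]expn1 pfactor_dvdn ?prime_nth_prime ?code_gt0 // logn_code.
by case: (i < size u).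
Qed.

(** Since exponents are shifted by one, the primes dividing a code give the length; the exponents
    then give the entries. *)
Lemma code_inj : injective code.
Proof.
move=> u w uw; apply: (@eq_from_nth _ 0) => [|i].
  by case: (ltngtP (size u) (size w)) => // h;
     have := dvdn_code u (size u); have := dvdn_code w (size w);
     have := dvdn_code u (size w); have := dvdn_code w (size u);
     rewrite uw h !ltnn; lia.
move=> iu; have := logn_code u i; rewrite uw iu logn_code.
by case: ifP => // _ [].
Qed.

Lemma codeK : cancel code decode.
Proof. by move=> u; apply: xget_unique => // w /code_inj. Qed.

Lemma entry_code u i : entry (code u) i = nth 0 u i.
Proof. by rewrite /entry codeK. Qed.

Lemma decodeP s : code (decode s) = s \/ decode s = [::].
Proof. by rewrite /decode; case: xgetP; [left|right]. Qed.

(** An entry [x] contributes a prime power with exponent [x.+1] to the code; off codes every entry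
    is 0. The course-of-values arguments below rest on this bound. *)
Lemma entry_le s i : entry s i <= s.
Proof.
rewrite /entry; case: (decodeP s) => [|->]; last by rewrite nth_nil.
move: (decode s) => u <-; case: (ltnP i (size u)) => [iu|]; last first.
  by move=> h; rewrite nth_default.
have := logn_code u i; rewrite iu => lE.
have := pfactor_dvdnn (nth_prime i) (code u); rewrite lE => /(dvdn_leq (code_gt0 u)).
apply: leq_trans; apply: ltnW; apply: ltn_trans (ltnSn _) _.
by apply: ltn_expl; rewrite prime_gt1 ?prime_nth_prime.
Qed.

(** [decode] is defined by choice; this form is computable: [s] is a code exactly when re-encoding
    its exponents up to some length at most [s] returns [s]. *)
Lemma entryE s i : entry s i =
  if has (fun d => code (mkseq (fun j => (logn (nth_prime j) s).-1) d) == s) (iota 0 s.+1)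
  then (logn (nth_prime i) s).-1 else 0.
Proof.
have loE u : mkseq (fun j => (logn (nth_prime j) (code u)).-1) (size u) = u.
  apply: (@eq_from_nth _ 0); rewrite size_mkseq // => j ju.
  by rewrite nth_mkseq // logn_code ju.
case: hasP => [[d _ /eqP <-]|no].
  by rewrite entry_code logn_code; case: ltnP => // /(nth_default 0).
rewrite /entry; case: (decodeP s) => [sE|->]; last by rewrite nth_nil.
case: no; exists (size (decode s)).
  by rewrite mem_iota leq0n add0n ltnS -{2}sE size_code.
by rewrite -{1}sE loE sE.
Qed.

Lemma count_ltn_iota l x : l <= x -> count (fun e => e < l) (iota 0 x) = l.
Proof.
move=> le; rewrite -(subnKC le) iotaD count_cat.
rewrite (_ : count _ (iota 0 l) = l).
  rewrite (_ : count _ _ = 0) ?addn0 //; apply/eqP; rewrite -leqn0 leqNgt -has_count.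
  by apply/hasPn => e; rewrite mem_iota add0n -leqNgt => /andP[].
rewrite -[RHS](size_iota 0); apply/eqP; rewrite -all_count; apply/allP => e.
by rewrite mem_iota.
Qed.

Lemma rec_logn n (f g : n.-tuple nat -> nat) : recursive f -> recursive g ->
  recursive (fun v => logn (nth_prime (f v)) (g v)).
Proof.
move=> rf rg.
have : recursive (fun v =>
  if g v == 0 then 0 else count (fun e => nth_prime (f v) ^ e.+1 %| g v) (iota 0 (g v))).
  by prove_rec.
move/rec_ext; apply=> v; case: eqP => [->|/eqP]; first by rewrite logn0.
rewrite -lt0n => g0; have pp := prime_nth_prime (f v).
under eq_count do rewrite pfactor_dvdn //.
have le : logn (nth_prime (f v)) (g v) <= g v.
  by apply: ltnW; apply: leq_trans (ltn_expl _ (prime_gt1 pp)) (dvdn_leq g0 (pfactor_dvdnn _ _)).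
exact: count_ltn_iota.
Qed.
#[local] Hint Resolve rec_logn : recursive.

Lemma rec_entry n (f g : n.-tuple nat -> nat) : recursive f -> recursive g ->
  recursive (fun v => entry (f v) (g v)).
Proof.
move=> rf rg.
have : recursive (fun v => if has (fun d => iteri d (fun j r =>
    r * nth_prime j ^ (logn (nth_prime j) (f v)).-1.+1) 1 == f v) (iota 0 (f v).+1)
  then (logn (nth_prime (g v)) (f v)).-1 else 0) by prove_rec.
move/rec_ext; apply=> v; rewrite entryE; congr (if _ then _ else _).
apply: eq_has => d; congr (_ == _); elim: d => [|d /= ->].
  by rewrite /code big_ord0.
by rewrite [in RHS]mkseqS code_rcons size_mkseq.
Qed.
#[local] Hint Resolve rec_entry : recursive.

Lemma code1E a : code [:: a] = 2 ^ a.+1.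
Proof. by rewrite -[[:: a]]/(rcons [::] a) code_rcons /code big_ord0 mul1n. Qed.

Lemma code2E a b : code [:: a; b] = 2 ^ a.+1 * nth_prime 1 ^ b.+1.
Proof. by rewrite -[[:: a; b]]/(rcons [:: a] b) code_rcons code1E. Qed.

Lemma code3E a b c : code [:: a; b; c] = 2 ^ a.+1 * nth_prime 1 ^ b.+1 * nth_prime 2 ^ c.+1.
Proof. by rewrite -[[:: a; b; c]]/(rcons [:: a; b] c) code_rcons code2E. Qed.

Lemma rec_code1 n (f : n.-tuple nat -> nat) :
  recursive f -> recursive (fun v => code [:: f v]).
Proof. by move=> rf; under eq_fun do rewrite code1E; prove_rec. Qed.

Lemma rec_code2 n (f g : n.-tuple nat -> nat) :
  recursive f -> recursive g -> recursive (fun v => code [:: f v; g v]).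
Proof. by move=> rf rg; under eq_fun do rewrite code2E; prove_rec. Qed.

Lemma rec_code3 n (f g h : n.-tuple nat -> nat) :
  recursive f -> recursive g -> recursive h ->
  recursive (fun v => code [:: f v; g v; h v]).
Proof. by move=> rf rg rh; under eq_fun do rewrite code3E; prove_rec. Qed.
#[local] Hint Resolve rec_code1 rec_code2 rec_code3 : recursive.

(** * Balls *)

Delimit Scope R_scope with real.

(** Cross multiplication; it makes comparisons of distances with radii decidable on natural
    numbers. *)
Lemma ltR_q m n t :
  Rlt (Rdiv (INR m) (INR n.+1)) (q t) <-> m * (entry t 1).+1 < entry t 0 * n.+1.
Proof.
have n0 : (0 < INR n.+1)%real by apply: lt_0_INR; apply/ltP.
have k0 : (0 < INR (entry t 1).+1)%real by apply: lt_0_INR; apply/ltP.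
have cross (a b c d : R) : (0 < b -> 0 < d -> a / b < c / d <-> a * d < c * b)%real.
  move=> b0 d0; split=> h.
    apply: (Rmult_lt_reg_r (/ b * / d)%real).
      by apply: Rmult_lt_0_compat; apply: Rinv_0_lt_compat.
    have -> : (a * d * (/ b * / d) = a / b)%real by field; split; lra.
    by have -> : (c * b * (/ b * / d) = c / d)%real by field; split; lra.
  apply: (Rmult_lt_reg_r (b * d)%real); first exact: Rmult_lt_0_compat.
  have -> : (a / b * (b * d) = a * d)%real by field; lra.
  by have -> : (c / d * (b * d) = c * b)%real by field; lra.
rewrite /q cross // -!mult_INR; split=> [/INR_lt /ltP //|h].
by apply: lt_INR; apply/ltP.
Qed.

Lemma lt0_q t : Rlt (INR 0) (q t) <-> 0 < entry t 0.
Proof.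
by rewrite -[INR 0]Rdiv_1_r -[IZR 1]/(INR 1) ltR_q mul0n muln1.
Qed.

Lemma omega_distP (m n t : nat) : Rlt (INR (m != n)) (q t) <->
  0 < entry t 0 /\ (m != n -> (entry t 1).+1 < entry t 0).
Proof.
rewrite -[INR _]Rdiv_1_r -[IZR 1]/(INR 1) ltR_q muln1.
case: eqP => _ /=; first by rewrite mul0n; split=> // -[].
rewrite mul1n; split=> [h|[_ ->] //].
by split=> //; exact: leq_ltn_trans (leq0n _) h.
Qed.

(** Membership in a ball as a decidable condition: if [x] and [y] first differ beyond index
    [entry t 1], their distance is less than [1 / (entry t 1).+1], which is at most any positive
    radius [q t]. *)
Definition near (T : eqType) (x y : nat -> T) (t : nat) : bool :=
  (0 < entry t 0) &&
  all (fun i => (x i != y i) ==> ((entry t 1).+1 < entry t 0 * i.+1))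
    (iota 0 (entry t 1).+1).

Lemma nearP (T : eqType) (x y : nat -> T) t :
  reflect (0 < entry t 0 /\ forall i, i <= entry t 1 -> x i != y i ->
             (entry t 1).+1 < entry t 0 * i.+1)
    (near x y t).
Proof.
apply: (iffP andP) => -[t0 h]; split=> //.
  by move=> i ik; move/allP/(_ i): h; rewrite mem_iota ltnS ik => /(_ isT)/implyP.
by apply/allP => i; rewrite mem_iota ltnS => ik; apply/implyP; apply: h.
Qed.

(* The first difference of [x] and [y] is the worst one, and a first difference
   beyond [entry t 1] puts them at distance less than [1 / (entry t 1).+1]. *)
Lemma seq_distP (T : eqType) (x y : nat -> T) t : Rlt (seq_dist x y) (q t) <-> near x y t.
Proof.
rewrite /seq_dist; case: pselect => [h|h]; last first.
  rewrite lt0_q; split=> [t0|/nearP[]//]; apply/nearP; split=> // i _ xy.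
  by case: h; exists i.
case: ex_minnP => n xn nmin; rewrite ltR_q mul1n; split=> [lt|/nearP[t0 hn]].
  apply/nearP; split; first by case: (entry t 0) lt => //; rewrite mul0n.
  move=> i _ /nmin ni; apply: leq_trans lt _.
  by rewrite leq_mul2l ltnS ni orbT.
case: (leqP n (entry t 1)) => [nk|kn]; first exact: hn.
by apply: (@leq_trans n.+1) => //; rewrite leq_pmull.
Qed.

Lemma near_eq (T : eqType) (x y y' : nat -> T) t :
  (forall i, i <= entry t 1 -> y i = y' i) -> near x y t = near x y' t.
Proof.
move=> yy; apply/nearP/nearP => -[t0 h]; split=> // i it.
  by rewrite -(yy i it); apply: h.
by rewrite (yy i it); apply: h.
Qed.

Lemma near_agree (T : eqType) (x y : nat -> T) t L :
  entry t 0 = 1 -> entry t 1 = L -> near x y t <-> forall i, i <= L -> x i = y i.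
Proof.
move=> t0 t1; split=> [/nearP[_ h] i|h]; last first.
  by apply/nearP; rewrite t0; split=> // i; rewrite t1 => /h ->; rewrite eqxx.
rewrite t0 t1 in h; move=> iL; apply/eqP/negPn/negP => /(h _ iL).
by rewrite mul1n ltnS ltnNge iL.
Qed.

Lemma ball_Baire s x : ball Baire s x <-> near (entry (entry s 0)) x (entry s 1).
Proof. exact: seq_distP. Qed.

Lemma ball_Cantor s (x : Cantor) :
  ball Cantor s x <-> near (fun n => entry (entry s 0) n != 0) x (entry s 1).
Proof. exact: seq_distP. Qed.

Lemma dist_prodP (X Y : presented) (p p' : prodp X Y) r :
  Rlt (dist p p') r <-> Rlt (dist p.1 p'.1) r /\ Rlt (dist p.2 p'.2) r.
Proof. by split=> [/Rmax_Rlt|h]; last apply/Rmax_Rlt. Qed.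

Lemma ball_prod (X Y : presented) s (x : X) (y : Y) : ball (prodp X Y) s (x, y) <->
  Rlt (dist (rpoint X (entry (entry s 0) 0)) x) (q (entry s 1)) /\
  Rlt (dist (rpoint Y (entry (entry s 0) 1)) y) (q (entry s 1)).
Proof. exact: dist_prodP. Qed.

(** The radius is 1, so in a product of discrete spaces the ball is the single point named by
    [c]. *)
Definition unit_ball c := code [:: c; code [:: 1]].

Lemma ball_point n s m t : ball (prodp omega omega) (unit_ball (code [:: n; s])) (m, t) <->
  m = n /\ t = s.
Proof.
rewrite ball_prod /= !omega_distP /unit_ball; do 3 rewrite ?entry_code /=.
split=> [[[_ h1] [_ h2]]|[-> ->]]; last by rewrite !eqxx.
by split; apply/esym/eqP/negPn/negP; [move/h1|move/h2].
Qed.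

Lemma entry0 i : entry 0 i = 0.
Proof. by have := entry_le 0 i; case: (entry 0 i). Qed.

(** Ball number 0 has radius 0; enumerations below emit it as their default value. *)
Lemma ball0_omega2 m t : ~ ball (prodp omega omega) 0 (m, t).
Proof. by rewrite ball_prod /= !omega_distP !entry0 => -[[]]. Qed.

Lemma near_radius (T : eqType) (x y : nat -> T) L :
  near x y (code [:: 1; L]) <-> forall i, i <= L -> x i = y i.
Proof. by apply: near_agree; rewrite entry_code. Qed.

(** One inclusion suffices: the cylinder around the prefix of [x] of length [n.+1] fixes the value
    of [y] at [n]. Uniqueness in [kleene] comes from here. *)
Lemma ball_Baire_inj (x y : Baire) :
  (forall s, ball Baire s x -> ball Baire s y) -> x = y.
Proof.
move=> h; apply/funext => n.
have /h : ball Baire (code [:: code (mkseq x n.+1); code [:: 1; n]]) x.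
  rewrite ball_Baire !entry_code /= near_radius => i i_n.
  by rewrite entry_code nth_mkseq.
rewrite ball_Baire !entry_code /= near_radius => /(_ n (leqnn n)) <-.
by rewrite entry_code nth_mkseq.
Qed.

(** * Codes of trees *)

Lemma rec_near n (x y : n.-tuple nat -> nat -> nat) (t : n.-tuple nat -> nat) :
  recursive (fun w => x (tl w) (hd w)) -> recursive (fun w => y (tl w) (hd w)) ->
  recursive t -> recursive (fun v => near (x v) (y v) (t v)).
Proof. by move=> rx ry rt; rewrite /near; prove_rec. Qed.
#[local] Hint Resolve rec_near : recursive.

(* [lab a b p] is 0 when [p] has the children [child p n], and [l.+1] when [p] is a
   leaf, whose code is then 0 followed by the constant [l].  A table [t] has entries
   [p, k, w_0, ..., w_(k-1)] and claims that the [w_i] are the first values of the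
   code at [p]. *)
Section CodeTree.
Variables (lab : (nat -> nat) -> (nat -> nat) -> nat -> nat) (child : nat -> nat -> nat).

(** The second condition makes the table long enough to cover the indices consulted by the ball
    [s]. *)
Definition shows (t s : nat) : bool :=
  near (entry (entry s 0)) (fun i => entry t i.+2) (entry s 1) &&
  (entry (entry s 1) 1 < entry t 1).

(** [val] stands for correctness of tables, still to be defined; a positive position [i] queries it
    only on an entry of [i.-1], hence below [i]. *)
Definition wstep (a b : nat -> nat) (val : nat -> bool) (p i : nat) : nat :=
  if i == 0 then nat_of_bool (lab a b p == 0)
  else if lab a b p == 0 then
    let m := i.-1 in
    if val (entry m 2) && (entry (entry m 2) 0 == child p (entry m 0)) &&
       shows (entry m 2) (entry m 1)
    then unit_ball (code [:: entry m 0; entry m 1]) else 0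
  else (lab a b p).-1.

Definition vstep (a b : nat -> nat) (val : nat -> bool) (t : nat) : bool :=
  all (fun i => entry t i.+2 == wstep a b val (entry t 0) i) (iota 0 (entry t 1)).

(** Course-of-values recursion made primitive: the accumulator is the sequence code of the
    correctness bits of all tables below [t], starting from 1, the code of the empty sequence. *)
Definition hist (a b : nat -> nat) (t : nat) : nat :=
  iteri t (fun k h => h * nth_prime k ^ (vstep a b (fun j => entry h j != 0) k).+1) 1.

Definition valid (a b : nat -> nat) (t : nat) : bool :=
  vstep a b (fun j => entry (hist a b t) j != 0) t.

Definition word (a b : nat -> nat) (p : nat) : nat -> nat := wstep a b (valid a b) p.

(** * Words over fixed oracles *)

Section Values.
Variables a b : nat -> nat.

Lemma wstep_ext (val val' : nat -> bool) p i :
  (forall t, t < i -> val t = val' t) -> wstep a b val p i = wstep a b val' p i.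
Proof.
move=> vv; rewrite /wstep; case: i vv => //= i vv.
by rewrite vv // ltnS entry_le.
Qed.

Lemma vstep_ext (val val' : nat -> bool) t :
  (forall j, j < t -> val j = val' j) -> vstep a b val t = vstep a b val' t.
Proof.
move=> vv; apply: eq_in_all => i; rewrite mem_iota add0n => /= it.
congr (_ == _); apply: wstep_ext => j ji; apply: vv.
exact: leq_trans (leq_trans ji (ltnW it)) (entry_le t 1).
Qed.

Lemma histE t : hist a b t = code (mkseq (fun j => valid a b j : nat) t).
Proof.
elim: t => [|t IH]; first by rewrite /code big_ord0.
by rewrite mkseqS code_rcons size_mkseq -IH.
Qed.

Lemma entry_hist j t : j < t -> (entry (hist a b t) j != 0) = valid a b j.
Proof. by move=> jt; rewrite histE entry_code nth_mkseq // eqb0 negbK. Qed.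

(** Closes the recursion: the history agrees with [valid] below [t], so [valid] itself may replace
    it, which turns [wstep] into [word]. *)
Lemma validP t :
  reflect (forall i, i < entry t 1 -> entry t i.+2 = word a b (entry t 0) i) (valid a b t).
Proof.
rewrite /valid (vstep_ext (@entry_hist^~ t)); apply: (iffP allP) => h i.
  by move=> it; apply/eqP/h; rewrite mem_iota.
by rewrite mem_iota => it; apply/eqP/h.
Qed.

Lemma word_hist p i :
  word a b p i = wstep a b (fun j => entry (hist a b i) j != 0) p i.
Proof. by apply: wstep_ext => j /entry_hist ->. Qed.

Lemma word0 p : word a b p 0 = (lab a b p == 0).
Proof. by []. Qed.

Lemma word_leaf p l i : lab a b p = l.+1 -> word a b p i.+1 = l.
Proof. by rewrite /word /wstep /= => ->. Qed.

(** Membership in a ball is witnessed by a long enough table of true values; conversely a correct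
    table agrees with the child's word wherever the ball looks. *)
Lemma word_kleene p n : lab a b p = 0 ->
  kleene (shift (word a b p)) n (word a b (child p n)).
Proof.
move=> lab0.
have wE m : word a b p m.+1 =
    if valid a b (entry m 2) && (entry (entry m 2) 0 == child p (entry m 0)) &&
       shows (entry m 2) (entry m 1)
    then unit_ball (code [:: entry m 0; entry m 1]) else 0.
  by rewrite /word /wstep /= lab0.
have spec s : ball Baire s (word a b (child p n)) <->
    univ_open (prodp omega omega) (shift (word a b p)) (n, s).
  rewrite ball_Baire; split=> [nr|[m _]].
    pose k := (entry (entry s 1) 1).+1.
    have [t [t0 t1 t2]] : exists t, [/\ entry t 0 = child p n, entry t 1 = k &
        forall i, i < k -> entry t i.+2 = word a b (child p n) i].
      exists (code [:: child p n, k & mkseq (word a b (child p n)) k]).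
      by split=> [| |i ik]; rewrite entry_code //= nth_mkseq.
    exists (code [:: n; s; t]) => //.
    have vt : valid a b t by apply/validP => i; rewrite t0 t1; apply: t2.
    have st : shows t s.
      rewrite /shows t1 ltnS leqnn andbT; apply: etrans nr; apply: near_eq => i ik.
      exact: t2.
    by rewrite /shift wE !entry_code /= vt st t0 eqxx; apply/ball_point.
  rewrite /shift wE; case: ifP => [/andP[/andP[/validP vt /eqP t0] /andP[st t1]]|_].
    move/ball_point => [nE sE]; rewrite nE in t0 *; rewrite sE in st t1 *.
    rewrite -t0; apply: etrans st; apply/esym/near_eq => i ik; apply: vt.
    exact: leq_ltn_trans ik t1.
  by move/ball0_omega2.
split=> // y' y'P; apply: ball_Baire_inj => s /spec ?; exact/y'P.
Qed.

End Values.

(** * Dependence on finite parts of the oracles *)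

Section Locality.
Hypothesis lab_local : forall a a' b b' p,
  (forall i, i < p -> a i = a' i) -> (forall i, i < p -> b i = b' i) ->
  lab a b p = lab a' b' p.
Variables (a a' b b' : nat -> nat) (N : nat).
Hypotheses (aa : forall i, i < N -> a i = a' i) (bb : forall i, i < N -> b i = b' i).

Lemma wstep_local val p i : p <= N -> wstep a b val p i = wstep a' b' val p i.
Proof.
move=> pN; have labE : lab a b p = lab a' b' p.
  by apply: lab_local => j jp; [apply: aa | apply: bb]; exact: leq_trans jp pN.
by rewrite /wstep labE.
Qed.

Lemma valid_local t : t <= N -> valid a b t = valid a' b' t.
Proof.
elim/ltn_ind: t => t IH tN.
have e i : i < entry t 1 -> word a b (entry t 0) i = word a' b' (entry t 0) i.
  move=> it; rewrite /word wstep_local; last exact: leq_trans (entry_le _ _) tN.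
  apply: wstep_ext => j ji; have jt : j < t.
    exact: leq_trans (leq_trans ji (ltnW it)) (entry_le t 1).
  by apply: IH => //; apply: leq_trans (ltnW jt) tN.
by apply/validP/validP => h i it; rewrite h // e.
Qed.

Lemma word_local p i : p <= N -> i <= N -> word a b p i = word a' b' p i.
Proof.
move=> pN iN; rewrite /word wstep_local //; apply: wstep_ext => j ji.
by apply: valid_local; exact: leq_trans (ltnW ji) iN.
Qed.

End Locality.

(** * Recursiveness of the coding map *)

Section Recursive.
(** Oracles enter as coded finite sequences extended by zeros, the form in which a natural number
    can carry them. *)
Hypothesis rec_lab : forall n (f g p : n.-tuple nat -> nat),
  recursive f -> recursive g -> recursive p ->
  recursive (fun v => lab (entry (f v)) (entry (g v)) (p v)).
Hypothesis rec_child : forall n (p i : n.-tuple nat -> nat),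
  recursive p -> recursive i -> recursive (fun v => child (p v) (i v)).
Hypothesis lab_local : forall a a' b b' p,
  (forall i, i < p -> a i = a' i) -> (forall i, i < p -> b i = b' i) ->
  lab a b p = lab a' b' p.
#[local] Hint Resolve rec_lab rec_child : recursive.

Lemma rec_wstep n (f g h p i : n.-tuple nat -> nat) :
  recursive f -> recursive g -> recursive h -> recursive p -> recursive i ->
  recursive (fun v => wstep (entry (f v)) (entry (g v))
                        (fun j => entry (h v) j != 0) (p v) (i v)).
Proof.
by move=> rf rg rh rp ri; rewrite /wstep /shows /unit_ball; cbv zeta; prove_rec.
Qed.
#[local] Hint Resolve rec_wstep : recursive.

Lemma rec_hist n (f g t : n.-tuple nat -> nat) :
  recursive f -> recursive g -> recursive t ->
  recursive (fun v => hist (entry (f v)) (entry (g v)) (t v)).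
Proof. by move=> rf rg rt; rewrite /hist /vstep; prove_rec. Qed.
#[local] Hint Resolve rec_hist : recursive.

Lemma rec_word n (f g p i : n.-tuple nat -> nat) :
  recursive f -> recursive g -> recursive p -> recursive i ->
  recursive (fun v => word (entry (f v)) (entry (g v)) (p v) (i v)).
Proof. by move=> rf rg rp ri; under eq_fun do rewrite word_hist; prove_rec. Qed.
#[local] Hint Resolve rec_word : recursive.

Lemma recursive_map_word root :
  @recursive_map (prodp Baire Baire) Baire (fun ab => word ab.1 ab.2 root).
Proof.
(* [n] codes two finite oracles and a ball [s], and a box around them is emitted when their word
   lies in [s]. Its radius [1 / (s + root).+1] forces agreement up to [s + root], which covers the
   node and all positions that [s] consults; being at most 1, it also fixes the coordinate in
   [omega]. *)
pose e n := let s := entry n 2 in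
  if near (entry (entry s 0)) (word (entry (entry n 0)) (entry (entry n 1)) root) (entry s 1)
  then code [:: code [:: code [:: entry n 0; entry n 1]; s]; code [:: 1; s + root]]
  else 0.
exists e.
  have : recursive (fun v : 1.-tuple nat => e (hd v)) by rewrite /e; cbv zeta; prove_rec.
  by [].
have eE (a b : Baire) s n : ball (prodp (prodp Baire Baire) omega) (e n) ((a, b), s) <->
  [/\ s = entry n 2, forall i, i <= s + root -> entry (entry n 0) i = a i,
      forall i, i <= s + root -> entry (entry n 1) i = b i &
      near (entry (entry s 0)) (word (entry (entry n 0)) (entry (entry n 1)) root) (entry s 1)].
  rewrite /e; case: ifP => nr; last first.
    split=> [|[-> _ _]]; last by rewrite nr.
    by rewrite ball_prod /= omega_distP !entry0 => -[_ []].
  rewrite ball_prod dist_prodP /= omega_distP !seq_distP.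
  do 3 rewrite ?entry_code /=.
  rewrite !near_radius; split=> [[[ha hb] [_ hs]]|[-> ha hb _]].
    have -> : s = entry n 2 by apply/esym/eqP/negPn/negP => /hs.
    by [].
  by rewrite eqxx.
have word_agree (a b a' b' : nat -> nat) s :
    (forall i, i <= s + root -> a' i = a i) -> (forall i, i <= s + root -> b' i = b i) ->
    near (entry (entry s 0)) (word a' b' root) (entry s 1) =
    near (entry (entry s 0)) (word a b root) (entry s 1).
  move=> aa bb; apply: near_eq => i ik.
  apply: (@word_local lab_local _ _ _ _ (s + root)) => [j /ltnW|j /ltnW||].
  - exact: aa.
  - exact: bb.
  - exact: leq_addl.
  - apply: leq_trans (leq_addr _ _); apply: leq_trans ik _.
    exact: leq_trans (entry_le _ _) (entry_le _ _).
apply/seteqP; split=> -[[a b] s] /=.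
  rewrite ball_Baire => nr.
  pose N := (s + root).+1.
  have eN (c : Baire) i : i <= s + root -> entry (code (mkseq c N)) i = c i.
    by move=> iN; rewrite entry_code nth_mkseq.
  exists (code [:: code (mkseq a N); code (mkseq b N); s]) => //.
  apply/eE; rewrite !entry_code /=; split=> //; [exact: eN|exact: eN|].
  by rewrite (word_agree a b) //; exact: eN.
by move=> [n _ /eE[-> ha hb nr]]; rewrite ball_Baire -(word_agree a b _ _ _ ha hb).
Qed.


End Recursive.
End CodeTree.

(** * Levels of codes *)

Section Lexicographic.
Variables (T K : Type) (key : T -> K) (rK : K -> K -> Prop) (rT : T -> T -> Prop).

Definition lexi (x y : T) : Prop := rK (key x) (key y) \/ key x = key y /\ rT x y.

Lemma lexi_trans :
  (forall i j k, rK i j -> rK j k -> rK i k) ->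
  (forall x y z, key x = key y -> key y = key z -> rT x y -> rT y z -> rT x z) ->
  forall x y z, lexi x y -> lexi y z -> lexi x z.
Proof.
move=> tK tT x y z [xy|[xy rxy]] [yz|[yz ryz]].
- by left; exact: tK yz.
- by left; rewrite -yz.
- by left; rewrite xy.
- by right; split; [rewrite xy|exact: tT ryz].
Qed.

Lemma lexi_total :
  (forall i j, [\/ rK i j, i = j | rK j i]) ->
  (forall x y, key x = key y -> [\/ rT x y, x = y | rT y x]) ->
  forall x y, [\/ lexi x y, x = y | lexi y x].
Proof.
move=> tK tT x y; case: (tK (key x) (key y)) => [xy|xy|yx].
- by apply: Or31; left.
- case: (tT x y xy) => [rxy|->|ryx]; [apply: Or31|exact: Or32|apply: Or33]; by right.
- by apply: Or33; left.
Qed.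

(** Outer induction on the key, inner induction inside a fibre. Well-foundedness of [rT] is asked
    fibrewise because in an ordered sum the inner order changes with the summand. *)
Lemma lexi_wf :
  well_founded rK ->
  (forall k, well_founded (fun x y => [/\ key x = k, key y = k & rT x y])) ->
  well_founded lexi.
Proof.
move=> wK wT x; move: {2}(key x) (erefl (key x)) => k.
elim/(well_founded_ind wK): k x => k IHk x.
elim/(well_founded_ind (wT k)): x => x IHx xk.
constructor=> y [|[yx ryx]]; first by rewrite xk => /IHk; apply.
by apply: IHx; rewrite ?yx.
Qed.

End Lexicographic.

Lemma ltn_wf : well_founded (fun m n : nat => m < n).
Proof. by move=> n; elim/ltn_ind: n => n IH; constructor=> m /IH. Qed.

Lemma ltn_total3 (m n : nat) : [\/ m < n, m = n | n < m].
Proof. by case: (ltngtP m n); [constructor 1|constructor 3|constructor 2]. Qed.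

Definition wo_nat : countable_wo :=
  @CountableWO (fun m n : nat => m < n) (fun i j k => @ltn_trans j i k) ltn_total3 ltn_wf.

(** * Ordered sums of countable well-orderings *)

Section OrderedSum.
Variable W : nat -> countable_wo.

(** Neither 0 nor 1 codes a nonempty sequence, so both are free to serve as end points. *)
Definition sum_class (n : nat) : nat := match n with 0 => 0 | 1 => 2 | _ => 1 end.

(** The usual order breaks ties between numbers sharing their first two entries, so that the sum is
    total on all naturals. *)
Definition summand_lt (i : nat) : nat -> nat -> Prop :=
  lexi (entry^~ 1) (wo_lt (W i)) (fun m n => m < n).

(* A bottom element [0], then the [W i] in order with the position [k] of [W i]
   represented by the codes [n] with entries [i] and [k], then a top element [1]. *)
Definition sum_lt : nat -> nat -> Prop :=
  lexi sum_class (fun m n => m < n)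
    (lexi (entry^~ 0) (fun m n => m < n) (fun m n => summand_lt (entry m 0) m n)).

Lemma sum_trans i j k : sum_lt i j -> sum_lt j k -> sum_lt i k.
Proof.
have tr m n p : m < n -> n < p -> m < p := @ltn_trans n m p.
apply: lexi_trans => // {}i {}j {}k _ _; apply: lexi_trans => // {}i {}j {}k -> _.
by apply: lexi_trans => [x y z|x y z _ _]; [exact: wo_trans|exact: tr].
Qed.

Lemma sum_total i j : [\/ sum_lt i j, i = j | sum_lt j i].
Proof.
apply: lexi_total => [|{}i {}j _]; first exact: ltn_total3.
apply: lexi_total => [|{}i {}j ->]; first exact: ltn_total3.
by apply: lexi_total => [|x y _]; [exact: wo_total|exact: ltn_total3].
Qed.

Lemma sub_wf (T : Type) (r r' : T -> T -> Prop) :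
  (forall x y, r x y -> r' x y) -> well_founded r' -> well_founded r.
Proof.
move=> rr wr x; elim/(well_founded_ind wr): x => x IH.
by constructor=> y /rr; apply: IH.
Qed.

Lemma sum_wf : well_founded sum_lt.
Proof.
apply: lexi_wf => [|k]; first exact: ltn_wf.
suff : well_founded (lexi (entry^~ 0) (fun m n => m < n)
    (fun m n => summand_lt (entry m 0) m n)) by apply: sub_wf => x y [].
apply: lexi_wf => [|i]; first exact: ltn_wf.
apply: (@sub_wf _ _ (summand_lt i)) => [x y [-> _ //]|].
apply: lexi_wf => [|{}k]; first exact: wo_wf.
by apply: sub_wf ltn_wf => x y [].
Qed.

Definition wo_sum : countable_wo := CountableWO sum_trans sum_total sum_wf.

Lemma wo_sum_zero : wo_zero wo_sum 0.
Proof.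
have irr : ~ sum_lt 0 0.
  move: (sum_wf 0); elim=> x _ IH xx; exact: (IH x xx).
by move=> n /[dup] [[//|[]]]; case: n => [_ _|[|n]//] /irr.
Qed.

Variables (I : Type) (c : I -> nat).

Definition sum_pos (i xi : nat) : nat :=
  if `[< wo_zero (W i) xi >] then 0 else code [:: i; xi].

Lemma sum_class_code u : u <> [::] -> sum_class (code u) = 1.
Proof.
move=> u0; have := code_gt0 u; case uE: (code u) => [|[|k]] // _.
by case: u0; apply: code_inj; rewrite uE /code big_ord0.
Qed.

Lemma code_level_sum i xi a : code_level c (W i) xi a ->
  code_level c wo_sum (sum_pos i xi) a.
Proof.
elim/(well_founded_ind (wo_wf (W i))): xi a => xi IH a.
rewrite !code_levelE => -[[z a0]|[nz a1 h]].
  by left; rewrite /sum_pos asboolT //; split=> //; exact: wo_sum_zero.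
have -> : sum_pos i xi = code [:: i; xi] by rewrite /sum_pos asboolF.
have c1 eta : sum_class (code [:: i; eta]) = 1 by apply: sum_class_code.
right; split=> //; first by move/(_ 0); apply; left; rewrite c1.
move=> j; have [b kb [eta lt lb]] := h j; exists b => //.
exists (sum_pos i eta); last exact: IH.
rewrite /sum_pos; case: asboolP => _; first by left; rewrite c1.
right; rewrite !c1; split=> //; right; rewrite !entry_code; split=> //.
by left; rewrite !entry_code.
Qed.

End OrderedSum.

Lemma codes_leaf (I : Type) (c : I -> nat) (a : Baire) : a 0 = 0 -> codes c a.
Proof.
by move=> a0; exists wo_nat, 0; rewrite code_levelE; left; split.
Qed.

(** The children have levels in unrelated orderings. The ordered sum, indexed by [pickle] and padded
    with [wo_nat], puts all of them below its top position 1, where the parent goes. *)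
Lemma codes_node (I : countType) (c : I -> nat) (a : Baire) (b : I -> Baire) :
  a 0 = 1 -> (forall i, kleene (shift a) (c i) (b i)) ->
  (forall i, codes c (b i)) -> codes c a.
Proof.
move=> a1 kb /choice[W /choice[xi Wb]].
pose W' k := if unpickle k is Some i then W i else wo_nat.
have WE i : W' (pickle i) = W i by rewrite /W' pickleK.
exists (wo_sum W'), 1; rewrite code_levelE; right; split=> //.
  by move/(_ 0); apply; left.
move=> i; exists (b i) => //; exists (sum_pos W' (pickle i) (xi i)).
  rewrite /sum_pos; case: asboolP => _; first by left.
  by left; rewrite sum_class_code.
by apply: code_level_sum; rewrite WE.
Qed.

(** * The search tree and its codes *)

Lemma rec_near_bool n (x y : n.-tuple nat -> nat -> bool) (t : n.-tuple nat -> nat) :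
  recursive (fun w => x (tl w) (hd w)) -> recursive (fun w => y (tl w) (hd w)) ->
  recursive t -> recursive (fun v => near (x v) (y v) (t v)).
Proof. by move=> rx ry rt; rewrite /near; prove_rec. Qed.
#[local] Hint Resolve rec_near_bool : recursive.

Definition depth (p : nat) : nat := count (fun i => nth_prime i %| p) (iota 0 p).

Definition push (p n : nat) : nat := p * nth_prime (depth p) ^ n.+1.

Lemma depth_code u : depth (code u) = size u.
Proof.
by rewrite /depth (eq_count (dvdn_code u)) count_ltn_iota // size_code.
Qed.

Lemma push_code u n : push (code u) n = code (rcons u n).
Proof. by rewrite code_rcons /push depth_code. Qed.

Lemma depth_le p : depth p <= p.
Proof. by rewrite -[X in _ <= X](size_iota 0); exact: count_size. Qed.

(* A path lists numbers [<<x l, g l>, <y l, h l>>]; side 0 is [(x, g)], side 1 is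
   [(y, h)], and a component 0 entry is read as a bit by comparing it with 0. *)
Definition approx (p side j l : nat) : nat := entry (entry (entry p l) side) j.

(** Only the first [depth p] balls are tested, and only those looking at fewer than [depth p]
    coordinates, so the approximation already decides the answer and the test is local in [a]. *)
Definition kill (side : nat) (a : nat -> nat) (p : nat) : bool :=
  has (fun i => (entry (entry (a i) 1) 1 < depth p) &&
    near (fun l => entry (entry (entry (a i) 0) 0) l != 0)
         (fun l => approx p side 0 l != 0) (entry (a i) 1) &&
    near (entry (entry (entry (a i) 0) 1)) (approx p side 1) (entry (a i) 1))
  (iota 0 (depth p)).

Definition cut (p l : nat) : bool := (approx p 0 0 l != 0) && (approx p 1 0 l == 0).

(* 0 at a node where the search goes on, and [k.+1] where it fails and [V k]
   separates. *)
Definition status (a b : nat -> nat) (p : nat) : nat :=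
  if kill 0 a p then 1 else if kill 1 b p then 2
  else iteri (depth p) (fun l r => if cut p l then l.+3 else r) 0.

Lemma rec_depth n (p : n.-tuple nat -> nat) :
  recursive p -> recursive (fun v => depth (p v)).
Proof. by move=> rp; rewrite /depth; prove_rec. Qed.
#[local] Hint Resolve rec_depth : recursive.

Lemma rec_push n (p i : n.-tuple nat -> nat) :
  recursive p -> recursive i -> recursive (fun v => push (p v) (i v)).
Proof. by move=> rp ri; rewrite /push; prove_rec. Qed.
#[local] Hint Resolve rec_push : recursive.

Lemma rec_kill n side (f p : n.-tuple nat -> nat) :
  recursive f -> recursive p -> recursive (fun v => kill side (entry (f v)) (p v)).
Proof. by move=> rf rp; rewrite /kill /approx; prove_rec. Qed.
#[local] Hint Resolve rec_kill : recursive.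

Lemma rec_status n (f g p : n.-tuple nat -> nat) :
  recursive f -> recursive g -> recursive p ->
  recursive (fun v => status (entry (f v)) (entry (g v)) (p v)).
Proof. by move=> rf rg rp; rewrite /status /cut /approx; prove_rec. Qed.
#[local] Hint Resolve rec_status : recursive.

Lemma status_local a a' b b' p :
  (forall i, i < p -> a i = a' i) -> (forall i, i < p -> b i = b' i) ->
  status a b p = status a' b' p.
Proof.
have kill_local side c c' : (forall i, i < p -> c i = c' i) -> kill side c p = kill side c' p.
  move=> cc; apply: eq_in_has => i; rewrite mem_iota => /= ip.
  by rewrite cc //; exact: leq_trans ip (depth_le p).
by move=> aa bb; rewrite /status (kill_local 0 a a') // (kill_local 1 b b').
Qed.

(* [code [:: 0; p; 0]] carries the set C of the node [p], as a union of complements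
   of the sets carried by the [code [:: 1; p; i]].  The latter are the intersections
   over j of the C_(p, i, j), again as complements of unions of complements, except
   where C is U_n: there they are complements of balls exhausting U_n. *)
Definition borel_lab (a b : nat -> nat) (s : nat) : nat :=
  let st := status a b (entry s 1) in
  if entry s 0 == 0 then
    if st == 1 then (code [:: 0; code [:: 2]]).+1 else st == 2
  else if st <= 2 then 0
  else (if entry (entry s 2) (st - 3) == 0 then 0
        else code [:: entry s 2; code [:: 1; st - 3]]).+1.

Definition borel_child (s n : nat) : nat :=
  if entry s 0 == 0 then code [:: 1; entry s 1; n]
  else code [:: 0; push (entry s 1) (code [:: entry s 2; n]); 0].

Lemma rec_borel_lab n (f g s : n.-tuple nat -> nat) :
  recursive f -> recursive g -> recursive s ->
  recursive (fun v => borel_lab (entry (f v)) (entry (g v)) (s v)).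
Proof. by move=> rf rg rs; rewrite /borel_lab; cbv zeta; prove_rec. Qed.

Lemma rec_borel_child n (s i : n.-tuple nat -> nat) :
  recursive s -> recursive i -> recursive (fun v => borel_child (s v) (i v)).
Proof. by move=> rs ri; rewrite /borel_child; prove_rec. Qed.

Lemma borel_lab_local a a' b b' s :
  (forall i, i < s -> a i = a' i) -> (forall i, i < s -> b i = b' i) ->
  borel_lab a b s = borel_lab a' b' s.
Proof.
move=> aa bb; rewrite /borel_lab (@status_local a a' b b') // => i lt.
  by apply: aa; exact: leq_trans lt (entry_le s 1).
by apply: bb; exact: leq_trans lt (entry_le s 1).
Qed.

Definition sp_word (a b : nat -> nat) (u : seq nat) : Baire :=
  word status push a b (code u).

Definition borel_word (a b : nat -> nat) (u : seq nat) : Baire :=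
  word borel_lab borel_child a b (code [:: 0; code u; 0]).

Lemma semi_positive_code_node (a : Baire) (b : nat -> nat -> Baire)
    (P : nat -> nat -> set Cantor) :
  a 0 = 1 -> (forall i j, kleene (shift a) (code [:: i; j]) (b i j)) ->
  (forall i j, semi_positive_code (b i j) (P i j)) ->
  semi_positive_code a (\bigcup_i \bigcap_j P i j).
Proof.
move=> a1 kb bP; split; last by apply: Tau1 kb _ => // i j; have [] := bP i j.
apply: (@codes_node _ _ _ (fun p => b p.1 p.2)) => // -[i j] //=.
by have [] := bP i j.
Qed.

Lemma borel_code_node (X : presented) (a : Baire) (b : nat -> Baire)
    (P : nat -> set X) :
  a 0 = 1 -> (forall n, kleene (shift a) n (b n)) ->
  (forall n, borel_code (b n) (P n)) -> borel_code a (\bigcup_n ~` P n).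
Proof.
move=> a1 kb bP; split; last by apply: Pi_c1 kb _ => // n; have [] := bP n.
by apply: (@codes_node _ _ _ b) => // n; have [] := bP n.
Qed.

Lemma borel_code_leaf (X : presented) (a : Baire) :
  a 0 = 0 -> @borel_code X a (~` ball X (a 1)).
Proof. by move=> a0; split; [exact: codes_leaf|exact: Pi_c0]. Qed.

(** * Codes of the sets at a node *)

Section Codes.
Variables (a b : nat -> nat) (u : seq nat).

Lemma semi_positive_leaf k : status a b (code u) = k.+1 ->
  semi_positive_code (sp_word a b u) (V k).
Proof.
move=> st; have w0 : sp_word a b u 0 = 0 by rewrite /sp_word word0 st.
split; first exact: codes_leaf.
(* Semi-positive leaves are read at position 2, Borel leaves at position 1; a leaf word is constant
   after position 0. *)
by have := Tau0 w0; rewrite /shift /sp_word (word_leaf _ _ st).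
Qed.

Lemma semi_positive_node P : status a b (code u) = 0 ->
  (forall i j, semi_positive_code (sp_word a b (rcons u (code [:: i; j]))) (P i j)) ->
  semi_positive_code (sp_word a b u) (\bigcup_i \bigcap_j P i j).
Proof.
move=> st; apply: semi_positive_code_node; first by rewrite /sp_word word0 st.
by move=> i j; rewrite /sp_word -push_code; exact: word_kleene.
Qed.

Let inner i : Baire := word borel_lab borel_child a b (code [:: 1; code u; i]).

Lemma borel_inner P : borel_lab a b (code [:: 0; code u; 0]) = 0 ->
  (forall i, borel_code (inner i) (P i)) ->
  @borel_code Cantor (borel_word a b u) (\bigcup_i ~` P i).
Proof.
move=> st; apply: borel_code_node; first by rewrite /borel_word word0 st.
move=> i; have := @word_kleene borel_lab borel_child a b _ i st.
by rewrite [borel_child (code _) _]/borel_child !entry_code.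
Qed.

Lemma borel_node P : status a b (code u) = 0 ->
  (forall i j, borel_code (borel_word a b (rcons u (code [:: i; j]))) (P i j)) ->
  @borel_code Cantor (borel_word a b u) (\bigcup_i \bigcap_j P i j).
Proof.
(* Borel codes only build unions of complements, so the inner intersection becomes the complement of
   such a union. *)
move=> st bP; rewrite (eq_bigcupr (G := fun i => ~` \bigcup_j ~` P i j)); last first.
  by move=> i _; rewrite setC_bigcup; apply: eq_bigcapr => j _; rewrite setCK.
apply: borel_inner => [|i]; first by rewrite /borel_lab !entry_code /= st.
have lab0 : borel_lab a b (code [:: 1; code u; i]) = 0.
  by rewrite /borel_lab !entry_code /= st.
apply: borel_code_node (bP i); first by rewrite /inner word0 lab0.
move=> j; have := @word_kleene borel_lab borel_child a b _ j lab0.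
by rewrite [borel_child (code _) _]/borel_child !entry_code /= push_code.
Qed.

Lemma borel_leaf k : status a b (code u) = k.+1 ->
  @borel_code Cantor (borel_word a b u) (V k).
Proof.
case: k => [|[|n]] st.
- have lab0 : borel_lab a b (code [:: 0; code u; 0]) = (code [:: 0; code [:: 2]]).+1.
    by rewrite /borel_lab !entry_code /= st.
  have w0 : borel_word a b u 0 = 0 by rewrite /borel_word word0 lab0.
  have := borel_code_leaf Cantor w0; rewrite /borel_word (word_leaf _ _ lab0).
  (* Radius 2 exceeds every distance, so the complement of the ball is empty. *)
  rewrite (_ : ball _ _ = setT) ?setCT //; apply/seteqP; split=> // x _.
  apply/ball_Cantor/nearP; do 2 rewrite ?entry_code /=; split=> // i _ _.
  by rewrite mulnS.
- have lab0 : borel_lab a b (code [:: 0; code u; 0]) = 1.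
    by rewrite /borel_lab !entry_code /= st.
  have w0 : borel_word a b u 0 = 0 by rewrite /borel_word word0 lab0.
  have := borel_code_leaf Cantor w0; rewrite /borel_word (word_leaf _ _ lab0).
  rewrite (_ : ball _ _ = set0) ?setC0 //; apply/seteqP; split=> // x.
  by rewrite ball_Cantor => /nearP[]; rewrite !entry0.
(* [U n] is the union of the cylinders of length [n.+1] whose last bit is 1; centres with bit 0
   contribute the empty ball 0. *)
pose t j := if entry j n == 0 then 0 else code [:: j; code [:: 1; n]].
have lab1 j : borel_lab a b (code [:: 1; code u; j]) = (t j).+1.
  by rewrite /borel_lab !entry_code /= st /= ?subSS ?subn0.
have -> : V n.+2 = \bigcup_j ~` ~` ball Cantor (t j).
  apply/seteqP; split=> [x xn|x [j _]].
    pose j := code (mkseq (fun i => x i : nat) n.+1).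
    have jE i : i <= n -> entry j i = x i by move=> in_; rewrite entry_code nth_mkseq.
    exists j => //; rewrite setCK ball_Cantor /t jE // (_ : x n = true) //=.
    rewrite !entry_code /= near_radius => i /jE ->.
    by case: (x i).
  rewrite setCK ball_Cantor /t; case: eqP => [_ /nearP[]|jn]; first by rewrite !entry0.
  rewrite !entry_code /= near_radius => /(_ n (leqnn n)) xn.
  by rewrite /U /= -xn; apply/eqP.
apply: borel_inner => [|j]; first by rewrite /borel_lab !entry_code /= st.
have w0 : inner j 0 = 0 by rewrite /inner word0 lab1.
have := borel_code_leaf Cantor w0.
by rewrite /inner (word_leaf _ _ (lab1 j)).
Qed.

End Codes.

(** * Separation *)

Definition follows (side : nat) (u : seq nat) (x : Cantor) (g : Baire) : Prop :=
  forall l, l < size u -> x l = (entry (entry (nth 0 u l) side) 0 != 0) /\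
                          g l = entry (entry (nth 0 u l) side) 1.

Lemma ball_CantorBaire t (x : Cantor) (g : Baire) :
  ball (prodp Cantor Baire) t (x, g) <->
  near (fun l => entry (entry (entry t 0) 0) l != 0) x (entry t 1) /\
  near (entry (entry (entry t 0) 1)) g (entry t 1).
Proof. by rewrite ball_prod !seq_distP. Qed.

Lemma kill_near side u x g t : follows side u x g -> entry (entry t 1) 1 < size u ->
  near (fun l => entry (entry (entry t 0) 0) l != 0)
       (fun l => approx (code u) side 0 l != 0) (entry t 1) &&
  near (entry (entry (entry t 0) 1)) (approx (code u) side 1) (entry t 1) <->
  ball (prodp Cantor Baire) t (x, g).
Proof.
move=> ug tu; rewrite ball_CantorBaire; split=> [/andP[h1 h2]|[h1 h2]].
  split; [apply: etrans h1|apply: etrans h2]; apply: near_eq => l lt;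
  by have [] := ug l (leq_ltn_trans lt tu); rewrite /approx entry_code.
apply/andP; split; [apply: etrans h1|apply: etrans h2]; apply: near_eq => l lt;
by have [] := ug l (leq_ltn_trans lt tu); rewrite /approx entry_code.
Qed.

Lemma kill_open side (a : Baire) u x g : kill side a (code u) -> follows side u x g ->
  univ_open (prodp Cantor Baire) a (x, g).
Proof.
move=> /hasP[i _]; rewrite -andbA depth_code => /andP[iu h] ug.
by exists i => //; apply/(kill_near ug iu).
Qed.

Lemma open_kill side (a : Baire) x g : univ_open (prodp Cantor Baire) a (x, g) ->
  exists N, forall u, N <= size u -> follows side u x g -> kill side a (code u).
Proof.
(* Deep enough for the ball with index [i] to be tested and for its radius to look only at known
   coordinates. *)
move=> [i _ ai]; exists (i + entry (entry (a i) 1) 1).+1 => u Nu ug.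
apply/hasP; exists i; first by rewrite mem_iota depth_code; lia.
have iu : entry (entry (a i) 1) 1 < size u by lia.
by rewrite -andbA depth_code iu; apply/(kill_near ug iu).
Qed.

Lemma cutP u x g y h l : follows 0 u x g -> follows 1 u y h ->
  l < size u -> cut (code u) l = x l && ~~ y l.
Proof.
move=> ux uy lu; rewrite /cut /approx entry_code.
by have [-> _] := ux l lu; have [-> _] := uy l lu; rewrite negbK.
Qed.

(** The iteration keeps the last cut coordinate [l] as [l.+3]: [V l.+2] is [U l], and a status
    exceeds the index of its set by one. *)
Lemma last_cut p d k : iteri d (fun l r => if cut p l then l.+3 else r) 0 = k ->
  if k is l.+3 then l < d /\ cut p l
  else k = 0 /\ forall l, l < d -> ~~ cut p l.
Proof.
elim: d k => [|d IH] k /= <- //; case: ifP => [cd|/negbT nd]; first by split.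
case: (iteri _ _ _) (IH _ erefl) => [|[|[|l]]] [] //= h1 h2.
  by split=> // l; rewrite ltnS leq_eqVlt => /predU1P[->|/h2].
by split=> //; exact: ltnW.
Qed.

Lemma follows_rcons side u x g i : follows side u x g ->
  entry i side = code [:: x (size u) : nat; g (size u)] ->
  follows side (rcons u i) x g.
Proof.
move=> ug iE l; rewrite size_rcons ltnS leq_eqVlt nth_rcons => /predU1P[->|lu].
  by rewrite ltnn eqxx iE !entry_code /=; case: (x _).
by rewrite lu; exact: ug.
Qed.

Section Separation.
Variables (a b : Baire).

Inductive bar : seq nat -> Prop :=
| Bar_stop u : status a b (code u) <> 0 -> bar u
| Bar_step u : (forall n, bar (rcons u n)) -> bar u.

(** An unbarred node has an unbarred child, so an unbarred root starts an infinite branch of status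
    0. Its limits [(x, g)] and [(y, h)] are never covered by an enumerated ball, so the hypothesis
    yields a cut, which a finite stage detects. *)
Lemma bar_nil :
  (forall x y g h, univ_closed (prodp Cantor Baire) a (x, g) ->
     univ_closed (prodp Cantor Baire) b (y, h) ->
     exists l, x l && ~~ y l) ->
  bar [::].
Proof.
move=> disj; apply: contrapT => nb.
have /choice[f fP] u : exists n, ~ bar u -> ~ bar (rcons u n).
  case: (pselect (bar u)) => [bu|nbu]; first by exists 0.
  have [n nbn] : exists n, ~ bar (rcons u n).
    by apply: contrapT => /forallNP h; apply: nbu; apply: Bar_step => n; exact: contrapT.
  by exists n.
pose w k := iter k (fun u => rcons u (f u)) [::].
have wE k : w k = mkseq (f \o w) k.
  by elim: k => // k IH; rewrite mkseqS -IH.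
have nbw k : ~ bar (w k) by elim: k => //= k; exact: fP.
have st k : status a b (code (mkseq (f \o w) k)) = 0.
  by apply: contrapT => h; apply: (nbw k); rewrite wE; exact: Bar_stop.
pose x side l := entry (entry (f (w l)) side) 0 != 0.
pose g side l := entry (entry (f (w l)) side) 1.
have fol side k : follows side (mkseq (f \o w) k) (x side) (g side).
  by move=> l; rewrite size_mkseq => lk; rewrite nth_mkseq.
have [|h1|l /andP[xl yl]] := disj (x 0) (x 1) (g 0) (g 1).
- move=> /(open_kill 0)[N /(_ (mkseq (f \o w) N))].
  by rewrite size_mkseq leqnn => /(_ isT (fol _ _)) kl; have := st N; rewrite /status kl.
- move: h1 => /(open_kill 1)[N /(_ (mkseq (f \o w) N))].
  rewrite size_mkseq leqnn => /(_ isT (fol _ _)) kl; have := st N.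
  by rewrite /status kl; case: ifP.
(* Depth [l.+1] is the first at which the bits at [l] are known. *)
have := st l.+1; rewrite /status; case: ifP => // _; case: ifP => // _.
move/last_cut => [_ /(_ l)]; rewrite depth_code size_mkseq => /(_ (ltnSn l)).
by rewrite (cutP (fol 0 _) (fol 1 _)) ?size_mkseq // xl yl.
Qed.

(** The part of the analytic set coded by [c] above a node; at the empty sequence it is the whole
    set. *)
Definition shadow (side : nat) (c : Baire) (u : seq nat) : set Cantor :=
  [set x | exists2 g, follows side u x g & univ_closed (prodp Cantor Baire) c (x, g)].

Lemma separation u : bar u -> exists C : set Cantor,
  [/\ semi_positive C, semi_positive_code (sp_word a b u) C,
      borel_code (borel_word a b u) C, shadow 0 a u `<=` C &
      forall y, shadow 1 b u y -> ~ C y].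
Proof.
have leaf v k : status a b (code v) = k.+1 -> exists C : set Cantor,
    [/\ semi_positive C, semi_positive_code (sp_word a b v) C,
      borel_code (borel_word a b v) C, shadow 0 a v `<=` C &
      forall y, shadow 1 b v y -> ~ C y].
  move=> st; exists (V k); split; [|exact: semi_positive_leaf|exact: borel_leaf| |].
  - by case: {st} k => [|[|n]]; [exact: SP_empty|exact: SP_full|exact: SP_U].
  - move=> x [g vx nx]; move: st; rewrite /status.
    case: ifP => [/kill_open/(_ vx)//|_]; case: ifP => [_ [<-]//|_ /last_cut].
    case: k => [|[|n]] [] //; rewrite depth_code => nv.
    by rewrite /cut /approx entry_code => /andP[xn _]; exact: etrans (proj1 (vx n nv)) xn.
  - move=> y [h vy ny]; move: st; rewrite /status.
    case: ifP => [_ [<-]//|_]; case: ifP => [/kill_open/(_ vy)//|_ /last_cut].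
    case: k => [|[|n]] [] //; rewrite depth_code => nv.
    rewrite /cut /approx entry_code => /andP[_ yn] /(etrans (esym (proj1 (vy n nv)))).
    by rewrite yn.
elim=> {u} [u|u _ IH]; first by case st: (status _ _ _) => [//|k] _; exact: leaf st.
(* A node barred through its children may itself have failed; it is then treated as a leaf. *)
case st: (status a b (code u)) => [|k]; last exact: leaf st.
have /choice[C CP] n := IH n.
pose P i j := C (code [:: i; j]).
exists (\bigcup_i \bigcap_j P i j); split.
- by apply: SP_bigcup => i; apply: SP_bigcap => j; have [] := CP (code [:: i; j]).
- by apply: semi_positive_node => // i j; have [] := CP (code [:: i; j]).
- by apply: borel_node => // i j; have [] := CP (code [:: i; j]).
(* Here [i] records the next values of [(x, g)]; every [j] is then compatible, as it extends the
   other side only. *)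
- move=> x [g ux nx]; exists (code [:: x (size u) : nat; g (size u)]) => // j _.
  have [_ _ _ h _] := CP (code [:: code [:: x (size u) : nat; g (size u)]; j]).
  by apply: h; exists g => //; apply: follows_rcons => //; rewrite entry_code.
(* Against any [i], the [j] recording the next values of [(y, h)] gives a set that misses [y]. *)
- move=> y [h uy ny] [i _ /(_ (code [:: y (size u) : nat; h (size u)]) I)].
  have [_ _ _ _ hC] := CP (code [:: i; code [:: y (size u) : nat; h (size u)]]).
  by apply: hC; exists h => //; apply: follows_rcons => //; rewrite entry_code.
Qed.

End Separation.

Theorem theorem1p2 :
  exists u v : prodp Baire Baire -> Baire,
    [/\ recursive_map u, recursive_map v &
      forall (a b : Baire) (A B : set Cantor),
        analytic_code a A -> analytic_code b B ->
        A `&` B = set0 -> monotone A ->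
        exists C : set Cantor,
          [/\ semi_positive C, A `<=` C, C `&` B = set0,
              borel_code (u (a, b)) C
            & semi_positive_code (v (a, b)) C]].
Proof.
exists (fun ab => borel_word ab.1 ab.2 [::]), (fun ab => sp_word ab.1 ab.2 [::]); split.
- apply: recursive_map_word; [exact: rec_borel_lab|exact: rec_borel_child|].
  exact: borel_lab_local.
- by apply: recursive_map_word; [exact: rec_status|exact: rec_push|exact: status_local].
move=> a b A B AE BE AB0 Amon.
have /separation[C [spC vC uC AC BC]] : bar a b [::].
  (* Without a separating coordinate [x <= y] pointwise, so monotonicity puts [y] into [A] as well
     as [B]. *)
  apply: bar_nil => x y g h ax bY; apply: contrapT => /forallNP xy.
  have : (A `&` B) y.
    split; last by rewrite BE; exists h.
    apply: (Amon x); first by rewrite AE; exists g.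
    by move=> l /= xl; have := xy l; rewrite xl; case: (y l).
  by rewrite AB0.
exists C; split=> //.
  by move=> x; rewrite AE => -[g ax]; apply: AC; exists g.
apply/seteqP; split=> // y [Cy]; rewrite BE => -[h bY].
by apply: BC Cy; exists h.
Qed.
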